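(* Let $p\ge1$, and consider the perturbed system $\dot x(t)=f(t,x(t))+u(t)$, $t\ge t_0$, where $u\in L^p_{\mathrm{loc}}([t_0,\infty);\mathbb{R}^n)$ is an external input. Let $m,M>0$ and $r>0$ be such that $$m\,\mathrm{dist}(x,E(t))^p\le W(t,x)\le M\,\mathrm{dist}(x,E(t))^p$$ for all $(t,x)\in[t_0,\infty)\times\mathbb{R}^n$ with $\mathrm{dist}(x,E(t))\le r$. Let $x(\cdot)$ be a solution of the perturbed system on $[t_0,\infty)$, write $d(t):=\mathrm{dist}(x(t),E(t))$, and assume $d(t)\le r$ for all $t\ge t_0$. Assume moreover that $\rho\in L^p_{\mathrm{loc}}([t_0,\infty))$ is nonnegative, and that $t\mapsto W(t,x(t))$ is locally absolutely continuous on $[t_0,\infty)$ and satisfies $$\frac{d}{dt}W(t,x(t))\le-\lambda W(t,x(t))+c\,(v_E(t)+\rho(t))^p+c_u\|u(t)\|^p\quad\text{for a.e. }t\ge t_0,$$ where $\lambda>0$ and $c,c_u\ge0$. Then there exists a constant $C>0$, depending only on $m,M,c,c_u,\lambda,p$, such that for every $t\ge t_0$, $$d(t)\le Ce^{-\lambda(t-t_0)/p}d(t_0)+C\Big(\int_{t_0}^te^{-\lambda(t-s)}(v_E(s)+\rho(s))^p\,ds\Big)^{1/p}+C\|u\|_{L^\infty(t_0,t)}.$$ In particular, if $v_E,\rho\in L^\infty([t_0,\infty))$ and $u\in L^\infty([t_0,\infty);\mathbb{R}^n)$, then $$\limsup_{t\to\infty}d(t)\le C\big(\|v_E\|_\infty+\|\rho\|_\infty+\|u\|_\infty\big),$$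 where $C>0$ again denotes a constant depending only on $m,M,c,c_u,\lambda,p$. Moreover, if $v_E,\rho\in L^p([t_0,\infty))$ and $u\in L^p([t_0,\infty);\mathbb{R}^n)$, then $d(t)\to0$ as $t\to\infty$.
   Context: Fix $t_0\ge 0$ and $f:[t_0,\infty)\times\mathbb{R}^n\to\mathbb{R}^n$ such that $t\mapsto f(t,x)$ is measurable for every $x$ and $x\mapsto f(t,x)$ is locally Lipschitz for a.e. $t\ge t_0$. Solutions of the perturbed system are locally absolutely continuous functions on $[t_0,\infty)$ satisfying the equation a.e. For nonempty $S$, $\mathrm{dist}(x,S)=\inf_{y\in S}\|x-y\|$. The equilibrium sets of the unperturbed system are $E(t):=\{x\in\mathbb{R}^n: f(t,x)=0\}$, assumed nonempty and closed for every $t\ge t_0$. For nonempty closed $A,B$ and $R>0$, $d_R^{\rm AW}(A,B):=\sup_{\|z\|\le R}|\mathrm{dist}(z,A)-\mathrm{dist}(z,B)|$. Standing assumption: $v_E\in L^1_{\mathrm{loc}}([t_0,\infty))$ (the equilibrium speed) is nonnegative and for every $R>0$ and $t_0\le s\le t$, $d_R^{\rm AW}(E(t),E(s))\le\int_s^t v_E(\tau)\,d\tau$. The function is $W:=V_1+\delta V_2$ with $\delta>0$ fixed and $V_1,V_2:[0,\infty)\times\mathbb{R}^n\to[0,\infty)$. $\|\cdot\|_\infty$ is the essential supremum norm over $[t_0,\infty)$. The integral and the norm $\|u\|_{L^\infty(t_0,t)}$ on the right-hand side of the first estimate are read as elements of $[0,\infty]$ (the estimate being void where one of them is $+\infty$).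 *)

(* Defs.v *)
From HB Require Import structures.
From mathcomp Require Import all_boot all_order all_algebra.
From mathcomp Require Import all_classical all_reals all_analysis.
From mathcomp Require Import measurable_realfun.

Set Implicit Arguments.
Unset Strict Implicit.
Unset Printing Implicit Defensive.

Import Order.TTheory GRing.Theory Num.Theory.
Import numFieldNormedType.Exports.

Local Open Scope classical_set_scope.
Local Open Scope ring_scope.

(* The norm of ['rV[R]_n] in the library is the sup norm; it induces the same
   topology, derivatives, absolutely continuous functions and locally Lipschitz
   functions as [enorm], and is used only for these notions. *)
Definition enorm (R : realType) (n : nat) (x : 'rV[R]_n) : R :=
  Num.sqrt (\sum_(i < n) x ord0 i ^+ 2).

Definition dist (R : realType) (n : nat) (x : 'rV[R]_n) (S : set 'rV[R]_n) : R :=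
  inf [set enorm (x - y) | y in S].

(* The Attouch-Wets distance at radius [r]. *)
Definition dAW (R : realType) (n : nat) (r : R) (A B : set 'rV[R]_n) : R :=
  sup [set `|dist z A - dist z B| | z in [set z | enorm z <= r]].

Definition equilibria (R : realType) (n : nat)
    (f : R -> 'rV[R]_n -> 'rV[R]_n) (t : R) : set 'rV[R]_n :=
  [set x | f t x = 0].

Definition locally_lipschitz (R : realType) (n : nat)
    (g : 'rV[R]_n -> 'rV[R]_n) : Prop :=
  forall x : 'rV[R]_n, exists2 U, nbhs x U & [lipschitz g y | y in U].

Definition abs_cont (R : realType) (V : normedModType R) (a b : R) (g : R -> V)
    : Prop :=
  forall e : R, 0 < e -> exists2 d : R, 0 < d &
    forall (k : nat) (l h : 'I_k -> R),
      (forall i, [/\ a <= l i, l i <= h i & h i <= b]) ->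
      trivIset [set: 'I_k] (fun i => `]l i, h i[%classic) ->
      \sum_(i < k) (h i - l i) < d ->
      \sum_(i < k) `|g (h i) - g (l i)| < e.

Definition loc_abs_cont (R : realType) (V : normedModType R) (t0 : R)
    (g : R -> V) : Prop :=
  forall b, t0 <= b -> abs_cont t0 b g.

(* Measurability is with respect to the completed Borel sigma-algebra, i.e. the
   Lebesgue-measurable sets. The library's [lebesgue_measure] lives on the Borel
   sets, but integrals against it (suprema over Borel simple functions) and
   essential suprema have the usual values on Lebesgue-measurable functions. *)
Definition lebesgue_measurable_fun (R : realType) (D : set R) (g : R -> R)
    : Prop :=
  @measurable_fun _ _
    (g_sigma_algebraType (completed_algebra_gen (@lebesgue_measure R))) R D g.

Definition Lp_norm (R : realType) (D : set R) (p : \bar R) (g : R -> R)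
    : \bar R :=
  'N[@lebesgue_measure R]_p[(EFin \o g) \_ D].

Definition in_Lp (R : realType) (D : set R) (p : \bar R) (g : R -> R) : Prop :=
  lebesgue_measurable_fun D g /\ (Lp_norm D p g < +oo)%E.

Definition in_Lp_loc (R : realType) (t0 : R) (p : \bar R) (g : R -> R) : Prop :=
  forall b, t0 <= b -> in_Lp `[t0, b] p g.

Definition vLp_norm (R : realType) (n : nat) (D : set R) (p : \bar R)
    (u : R -> 'rV[R]_n) : \bar R :=
  Lp_norm D p (fun s => enorm (u s)).

Definition in_vLp (R : realType) (n : nat) (D : set R) (p : \bar R)
    (u : R -> 'rV[R]_n) : Prop :=
  (forall i, lebesgue_measurable_fun D (fun s => u s ord0 i)) /\
  (vLp_norm D p u < +oo)%E.

Definition in_vLp_loc (R : realType) (n : nat) (t0 : R) (p : \bar R)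
    (u : R -> 'rV[R]_n) : Prop :=
  forall b, t0 <= b -> in_vLp `[t0, b] p u.

Definition is_solution (R : realType) (n : nat) (t0 : R)
    (f : R -> 'rV[R]_n -> 'rV[R]_n) (u x : R -> 'rV[R]_n) : Prop :=
  loc_abs_cont t0 x /\
  \forall t \ae (@lebesgue_measure R),
    t0 <= t -> is_derive t 1 x (f t (x t) + u t).

(* Main.v *)
(* On a set of full measure, the derivative of the absolutely continuous function
   e^(-lambda (b - t)) (w(t) - K / lambda) is at most that of the integral of
   e^(-lambda (b - s)) h(s) as soon as w' <= - lambda w + h + K, which gives
   w(b) <= e^(-lambda (b - a)) w(a) + K / lambda + int_a^b e^(-lambda (b - s)) h(s) ds.
   The three claims are instances: h = c (vE + rho)^p and K = c_u |u|_oo^p; then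
   h = 0 and K = c (|vE|_oo + |rho|_oo)^p + c_u |u|_oo^p; then
   h = c |vE + rho|^p + c_u |u|^p and K = 0, started at a time after which the
   integral of h is small. The p-th root of the estimate on w is distributed over
   the sum by superadditivity of x^p. *)
Require Import Defs.
From HB Require Import structures.
From mathcomp Require Import all_boot all_order all_algebra.
From mathcomp Require Import all_classical all_reals all_analysis.
From mathcomp Require Import measurable_realfun ess_sup_inf.
From mathcomp Require Import lra ring.

Set Implicit Arguments.
Unset Strict Implicit.
Unset Printing Implicit Defensive.

Import Order.TTheory GRing.Theory Num.Theory.
Import numFieldNormedType.Exports.

Local Open Scope classical_set_scope.
Local Open Scope ring_scope.

(** * Absolutely continuous functions on an interval *)

Lemma abs_cont_subitv (R : realType) (V : normedModType R) (a s b : R) (F : R -> V) :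
  a <= s -> abs_cont a b F -> abs_cont s b F.
Proof.
move=> as_ F_ac e e0; have [dl dl0 Fdl] := F_ac e e0; exists dl => // k l h lh.
by apply: Fdl => i; have [sl ? ?] := lh i; split => //; exact: le_trans sl.
Qed.

Lemma abs_cont_uniform (R : realType) (V : normedModType R) (a b : R)
    (F : R -> V) (e : R) :
  abs_cont a b F -> 0 < e -> exists2 dl : R, 0 < dl &
    forall s t, a <= s -> s <= t -> t <= b -> t - s < dl -> `|F t - F s| < e.
Proof.
move=> F_ac e0; have [dl dl0 Fdl] := F_ac e e0; exists dl => // s t as_ st tb ts.
have := Fdl 1%N (fun=> s) (fun=> t); rewrite !big_ord1; apply => //.
by move=> i j _ _ _; rewrite (ord1 i) (ord1 j).
Qed.

(** Walking from [a] in steps of length [dl / 2], each step changes [F] by less than 1, so the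
    number of steps needed to reach [b] bounds the total change. *)
Lemma abs_cont_bounded (R : realType) (V : normedModType R) (a b : R)
    (F : R -> V) :
  abs_cont a b F -> exists B : R, forall t, a <= t -> t <= b -> `|F t| <= B.
Proof.
move=> F_ac; have [dl dl0 Fdl] := abs_cont_uniform F_ac ltr01.
have steps (n : nat) : forall t, a <= t -> t <= b -> t - a < n%:R * (dl / 2) ->
    `|F t - F a| <= n%:R.
  elim: n => [|n IHn] t at_ tb; first by rewrite mul0r subr_lt0 ltNge at_.
  have [ts|/ltW ts] := leP (t - a) (dl / 2) => [_|].
    apply: (@le_trans _ _ 1); last by rewrite ler1n.
    by apply/ltW/Fdl => //; lra.
  rewrite -natr1 mulrDl mul1r => tn.
  rewrite -(subrK (F (t - dl / 2)) (F t)) -addrA addrC (le_trans (ler_normD _ _))//.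
  by apply: lerD; [apply: IHn|apply/ltW/Fdl]; lra.
exists (`|F a| + (Num.truncn ((b - a) / (dl / 2))).+1%:R) => t at_ tb.
rewrite -(subrK (F a) (F t)) addrC (le_trans (ler_normD _ _))// lerD2l.
apply: steps => //; rewrite -ltr_pdivrMr ?divr_gt0//.
apply: (@le_lt_trans _ _ ((b - a) / (dl / 2))); last exact: truncnS_gt.
by rewrite ler_pM2r ?invr_gt0 ?divr_gt0// lerB.
Qed.

(** The increment of a product is the increment of one factor times a value of the other, plus the
    same with the roles exchanged; both factors are bounded on the interval. *)
Lemma abs_contM (R : realType) (a b : R) (F G : R -> R) :
  abs_cont a b F -> abs_cont a b G -> abs_cont a b (F \* G).
Proof.
move=> F_ac G_ac e e0.
have [BF FB] := abs_cont_bounded F_ac; have [BG GB] := abs_cont_bounded G_ac.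
have BF0 : 0 < `|BF| + 1 by rewrite ltr_wpDl.
have BG0 : 0 < `|BG| + 1 by rewrite ltr_wpDl.
have [|dF dF0 FdF] := F_ac (e / 2 / (`|BG| + 1)); first by rewrite !divr_gt0.
have [|dG dG0 GdG] := G_ac (e / 2 / (`|BF| + 1)); first by rewrite !divr_gt0.
exists (Num.min dF dG) => [|k l h lh triv]; first by rewrite lt_min dF0.
rewrite lt_min => /andP[/(FdF _ _ _ lh triv) hF /(GdG _ _ _ lh triv) hG].
rewrite ltr_pdivlMr// in hF; rewrite ltr_pdivlMr// in hG.
rewrite (splitr e) (le_lt_trans _ (ltrD hF hG))// !mulr_suml -big_split/=.
apply: ler_sum => i _; have [al lhi hb] := lh i.
have -> : F (h i) * G (h i) - F (l i) * G (l i) =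
  (F (h i) - F (l i)) * G (h i) + (G (h i) - G (l i)) * F (l i) by ring.
rewrite (le_trans (ler_normD _ _))// !normrM.
by rewrite lerD// ler_wpM2l// ler_wpDr// (le_trans _ (ler_norm _))// ?FB ?GB//;
  lra.
Qed.

Lemma lipschitz_abs_cont (R : realType) (a b K : R) (F : R -> R) :
  (forall s t, a <= s -> s <= t -> t <= b -> `|F t - F s| <= K * (t - s)) ->
  abs_cont a b F.
Proof.
move=> F_lip e e0; have K0 : 0 < `|K| + 1 by rewrite ltr_wpDl.
exists (e / (`|K| + 1)) => [|k l h lh _]; first by rewrite divr_gt0.
rewrite ltr_pdivlMr//; apply: le_lt_trans; rewrite mulr_suml; apply: ler_sum => i _.
have [al lhi hb] := lh i; rewrite (le_trans (F_lip _ _ _ _ _))// mulrC.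
by rewrite ler_wpM2l ?subr_ge0// ler_wpDr// ler_norm.
Qed.

Lemma abs_contBr (R : realType) (V : normedModType R) (a b : R) (F : R -> V)
    (v : V) :
  abs_cont a b F -> abs_cont a b (fun t => F t - v).
Proof.
move=> F_ac e e0; have [dl dl0 Fdl] := F_ac e e0; exists dl => // k l h lh triv hd.
apply: le_lt_trans (Fdl k l h lh triv hd); apply: ler_sum => i _.
by rewrite opprB addrA subrK.
Qed.

(** * Growth of an absolutely continuous function controlled off a null set *)

Lemma trivIset_sum_itv_le (R : realType) (k : nat) (l h : 'I_k -> R) (U : set R) :
  measurable U -> (forall i, l i <= h i) ->
  trivIset [set: 'I_k] (fun i => `]l i, h i[%classic) ->
  (forall i, `]l i, h i[ `<=` U) ->
  ((\sum_(i < k) (h i - l i))%:E <= lebesgue_measure U)%E.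
Proof.
move=> mU lh triv sub.
have -> : (\sum_(i < k) (h i - l i))%:E =
    (\sum_(i < k) lebesgue_measure `]l i, h i[%classic)%E.
  rewrite -sumEFin; apply: eq_bigr => i _.
  rewrite lebesgue_measure_itv/= lte_fin -EFinB.
  have := lh i; rewrite le_eqVlt => /predU1P[->|->//].
  by rewrite ltxx subrr.
rewrite -(measure_bigsetU_ord _ xpredT)//.
apply: le_measure; rewrite ?inE//; first exact: bigsetU_measurable.
by move=> x; rewrite -bigcup_seq => -[i _]; exact: sub.
Qed.

(** The families have the shape used in [abs_cont], with the extra demand that the open intervals
    lie in [U]. The supremum is the variation that [F] accumulates inside [U] up to time [t]. *)
Definition variations (R : realType) (F : R -> R) (U : set R) (a t : R) : set R :=
  [set v | exists k (l h : 'I_k -> R),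
    [/\ forall i, [/\ a <= l i, l i <= h i & h i <= t],
        trivIset [set: 'I_k] (fun i => `]l i, h i[%classic),
        forall i, `]l i, h i[ `<=` U &
        v = \sum_(i < k) `|F (h i) - F (l i)|] ].

Lemma variations0 (R : realType) (F : R -> R) U a t : variations F U a t 0.
Proof.
by exists 0%N, (fun=> 0), (fun=> 0); split; [case|case|case|rewrite big_ord0].
Qed.

Lemma variationsS (R : realType) (F : R -> R) U a s t : s <= t ->
  variations F U a s `<=` variations F U a t.
Proof.
move=> st v [k [l [h [lh triv sub ->]]]]; exists k, l, h; split => // i.
by have [? ? /le_trans->] := lh i.
Qed.

Lemma variations_extend (R : realType) (F : R -> R) U a s t v :
  a <= s -> s <= t -> `]s, t[ `<=` U -> variations F U a s v ->
  variations F U a t (`|F t - F s| + v).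
Proof.
move=> as_ st stU [k [l [h [lh triv sub ->]]]].
(* Index 0 carries the new interval, through the default of [oapp]; the other indices carry the old
   family, which ends at [s] at the latest. *)
exists k.+1, (fun i => oapp l s (unlift ord0 i)), (fun i => oapp h t (unlift ord0 i)).
split => [i||i|].
- case: (unliftP ord0 i) => [j _|_] /=; last by split.
  by have [? ? /le_trans->] := lh j.
- move=> i j _ _.
  have disj (i0 : 'I_k) : `]l i0, h i0[ `&` `]s, t[ !=set0 -> False.
    move=> [x [/=]]; rewrite !in_itv/= => /andP[_ xh] /andP[sx _].
    have [_ _ hs] := lh i0; lra.
  case: (unliftP ord0 i) => [i' ->|->]; case: (unliftP ord0 j) => [j' ->|->] //=.
  + by move=> /(triv i' j' I I) ->.
  + by move=> /disj.
  + by rewrite setIC => /disj.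
- by case: (unliftP ord0 i) => [j _|_] //=; exact: sub.
- rewrite big_ord_recl unlift_none/=; congr (_ + _).
  by apply: eq_bigr => i _; rewrite liftK.
Qed.

(* Cover [N] by an open [U] of small measure and let [V t] be the supremum of the
   variations of [F] inside [U] up to [t], which is at most [e]. The set of [t] with
   [F t - F a <= G t - G a + V t + e * (t - a)] contains its supremum, and cannot
   stop before [b]: on [U] the increment of [F] is paid for by [V], off [U] by the
   derivative hypothesis. *)
Lemma abs_cont_le_growth (R : realType) (a b : R) (F G : R -> R) (N : set R) :
  a <= b -> abs_cont a b F ->
  (forall s t, a <= s -> s <= t -> t <= b -> G s <= G t) ->
  (@lebesgue_measure R).-negligible N ->
  (forall s, a <= s -> s < b -> ~ N s -> forall e : R, 0 < e ->
     \forall t \near s^'+, F t - F s <= G t - G s + e * (t - s)) ->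
  F b - F a <= G b - G a.
Proof.
move=> ab F_ac G_nd [N' [mN' N'0 NN']] FG.
apply/ler_addgt0Pr => e0 e0_gt0.
(* Chosen so that [e + e * (b - a) = e0]: one [e] pays for the variation inside [U], the other term
   for the slopes off [U]. *)
set e := e0 / (1 + (b - a)).
have ba1 : 0 < 1 + (b - a) by rewrite ltr_pwDl// subr_ge0.
have e_gt0 : 0 < e by rewrite divr_gt0.
have [dl dl0 Fdl] := F_ac e e_gt0.
have [U [oU N'U UN']] : exists U : set R,
    [/\ open U, N' `<=` U & (lebesgue_measure (U `\` N') < dl%:E)%E].
  by apply: lebesgue_regularity_outer => //; rewrite [X in (X < _)%E]N'0 ltry.
have mU : measurable U by exact: open_measurable.
have Udl : (lebesgue_measure U < dl%:E)%E.
  apply: le_lt_trans UN'.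
  rewrite -[X in (_ <= X)%E]adde0 -[X in (_ <= _ + X)%E]N'0.
  rewrite -measureU//; [|exact: measurableD|by rewrite setDKI].
  apply: le_measure; rewrite ?inE//; first exact: measurableU (measurableD _ _) _.
  by move=> x Ux; have [|] := pselect (N' x); [right|left].
pose V t := sup (variations F U a t).
have var_e t v : t <= b -> variations F U a t v -> v <= e.
  move=> tb [k [l [h [lh triv sub ->]]]]; apply/ltW/Fdl => // [i|].
    by have [? ? /le_trans->] := lh i.
  rewrite -lte_fin; apply: le_lt_trans Udl; apply: trivIset_sum_itv_le => // i.
  by have [] := lh i.
have var_V t v : t <= b -> variations F U a t v -> v <= V t.
  move=> tb vt; apply: ub_le_sup => //.
  by exists e => w; exact: var_e.
have V_e t : t <= b -> V t <= e.
  by move=> tb; apply: ge_sup => [|v]; [exists 0; exact: variations0|exact: var_e].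
have V_nd s t : s <= t -> t <= b -> V s <= V t.
  move=> st tb; apply: ge_sup; first by exists 0; exact: variations0.
  by move=> v /(variationsS st); exact: var_V.
pose P := [set t | [/\ a <= t, t <= b &
  F t - F a <= G t - G a + V t + e * (t - a)]].
have Pa : P a.
  split => //; rewrite !subrr mulr0 add0r addr0.
  by apply: var_V => //; exact: variations0.
have P_ub : has_ubound P by exists b => t [].
have P_sup : has_sup P by split => //; exists a.
set s := sup P.
have as_ : a <= s by exact: ub_le_sup.
have sb : s <= b by apply: ge_sup => [|t []//]; exists a.
(* [F] is continuous, and the right-hand side only grows with time, so the inequality passes from
   points of [P] close to [s] to [s] itself, up to any [eta]. *)
have [_ _ Ps] : P s.
  split => //; apply/ler_addgt0Pr => eta eta0.
  have [d' d'0 Fd'] := abs_cont_uniform F_ac eta0.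
  have [t [at_ tb Pt] st] := sup_adherent d'0 P_sup.
  have ts : t <= s by exact: ub_le_sup.
  have st' : s - t < d' by move: st; rewrite -/s; lra.
  have := Fd' t s at_ ts sb st'; have := ler_norm (F s - F t).
  have := G_nd t s at_ ts sb; have := V_nd t s ts sb.
  have : e * (t - a) <= e * (s - a) by rewrite (ler_wpM2l (ltW e_gt0))// lerD2r.
  lra.
suff sbE : s = b.
  move: Ps; rewrite sbE => /le_trans; apply.
  have := V_e b (lexx b).
  have -> : e0 = e + e * (b - a) by rewrite -{1}(mulr1 e) -mulrDr divfK// gt_eqF.
  lra.
(* If [s < b], a point of [P] beyond [s] is produced, against the choice of [s] as supremum. *)
apply/eqP/negPn/negP => sneb; have {sneb}sb' : s < b by rewrite lt_neqAle sneb.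
suff [t st Pt] : exists2 t, s < t & P t by have := ub_le_sup P_ub Pt; rewrite leNgt st.
have [Us|nUs] := pselect (U s).
  have /nbhs_ballP[eta /= eta0 Ueta] : nbhs s U by exact: open_nbhs_nbhs.
  pose t := Num.min b (s + eta / 2).
  have st : s < t by rewrite lt_min sb'/= ltrDl divr_gt0.
  have tb : t <= b by rewrite ge_min lexx.
  have tse : t <= s + eta / 2 by rewrite ge_min lexx orbT.
  exists t => //; split => //; first exact: le_trans as_ (ltW st).
  (* Each family counted in [V s] can be extended by the interval from [s] to [t], which lies in
     [U]. *)
  have VV : `|F t - F s| + V s <= V t.
    rewrite addrC -lerBrDr; apply: ge_sup; first by exists 0; exact: variations0.
    move=> v vs; rewrite lerBrDr addrC; apply: var_V => //.
    apply: variations_extend => //; first exact: ltW.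
    move=> x /=; rewrite in_itv/= => /andP[sx xt]; apply: Ueta.
    by rewrite /ball/= ltr_norml; apply/andP; split; lra.
  have := ler_norm (F t - F s); have := G_nd s t as_ (ltW st) tb.
  have : e * (s - a) <= e * (t - a) by rewrite (ler_wpM2l (ltW e_gt0))// lerD2r ltW.
  lra.
have nNs : ~ N s by move=> /NN' /N'U.
have FGs := FG s as_ sb' nNs e e_gt0.
near s^'+ => t.
have st : s < t by near: t; exact: nbhs_right_gt.
have tb : t <= b by near: t; exact: nbhs_right_le.
exists t => //; split => //; first exact: le_trans as_ (ltW st).
have : F t - F s <= G t - G s + e * (t - s) by near: t.
have := V_nd s t (ltW st) tb.
lra.
Unshelve. all: by end_near. Qed.

(** * The integrated differential inequality *)

Lemma is_derive_near_right_le (R : realType) (f : R -> R) (s df e : R) :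
  is_derive s 1 f df -> df <= 0 -> 0 < e ->
  \forall t \near s^'+, f t - f s <= e * (t - s).
Proof.
move=> f_df df0 e0.
have fE : h^-1 *: (f (h *: 1 + s) - f s) @[h --> 0^'] --> df.
  by have [/cvg_ex[l fl] <-] := f_df; rewrite /derive (cvg_lim _ fl).
have /cvgrPdist_lt/(_ e e0)/nbhs_ballP[d /= d0 fd] := fE.
near=> t.
have st : s < t by near: t; exact: nbhs_right_gt.
have ts0 : 0 < t - s by rewrite subr_gt0.
have td : t - s < d by rewrite ltrBlDl; near: t; apply: nbhs_right_lt; rewrite ltrDl.
have := fd (t - s); rewrite /ball/= sub0r normrN gtr0_norm// gt_eqF//.
move=> /(_ td isT).
rewrite [_ *: 1]mulr1 subrK distrC => /(le_lt_trans (ler_norm _))/ltW.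
rewrite lerBlDr => /le_trans/(_ (lerD (lexx e) df0)).
by rewrite addr0 [_ *: _]mulrC ler_pdivrMr.
Unshelve. all: by end_near. Qed.

(** The function is [lam]-Lipschitz on the interval, because the exponential is at most 1 there and
    1 - e^(-x) <= x. *)
Lemma abs_cont_expR (R : realType) (a b lam : R) : 0 <= lam ->
  abs_cont a b (fun t => expR (- lam * (b - t))).
Proof.
move=> lam0; apply: (@lipschitz_abs_cont _ _ _ lam) => s t as_ st tb.
have e1 : expR (- lam * (b - t)) <= 1.
  by rewrite -expR0 ler_expR mulNr oppr_le0 mulr_ge0// subr_ge0.
have -> : expR (- lam * (b - s)) = expR (- lam * (b - t)) * expR (- lam * (t - s)).
  by rewrite -expRD; congr expR; ring.
rewrite -{1}(mulr1 (expR (- lam * (b - t)))) -mulrBr normrM gtr0_norm ?expR_gt0//.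
have := expR_ge1Dx (- lam * (t - s)).
have e2 : expR (- lam * (t - s)) <= 1.
  by rewrite -expR0 ler_expR mulNr oppr_le0 mulr_ge0// subr_ge0.
rewrite ger0_norm ?subr_ge0// => e3.
rewrite (@le_trans _ _ (1 * (lam * (t - s))))// ?mul1r//.
rewrite -[leRHS]mul1r ler_pM ?expR_ge0 ?subr_ge0//; lra.
Qed.

(** The constant part [K] of the forcing is absorbed by the shift [w - K / lam]; the variable part
    [h] goes into the integral. The inequality is stated in the extended reals, since this integral
    may be infinite. *)
Lemma gronwall (R : realType) (a b lam K : R) (w h : R -> R) :
  a <= b -> 0 < lam -> abs_cont a b w -> measurable_fun setT h ->
  (forall s, 0 <= h s) ->
  (\forall s \ae (@lebesgue_measure R), a <= s -> s <= b -> derivable w s 1 /\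
     derive1 w s <= - lam * w s + h s + K) ->
  ((w b - K / lam)%:E <= (expR (- lam * (b - a)) * (w a - K / lam))%:E +
    \int[lebesgue_measure]_(s in `[a, b]) (expR (- lam * (b - s)) * h s)%:E)%E.
Proof.
move=> ab lam0 w_ac mh h0 w'_le.
set mu := @lebesgue_measure R.
pose H s := expR (- lam * (b - s)) * h s.
have H0 s : 0 <= H s by rewrite mulr_ge0 ?expR_ge0.
have mH : measurable_fun setT H.
  apply: measurable_funM => //; apply: measurableT_comp => //.
  by apply: measurable_funM => //; exact: measurable_funB.
have [Hoo|HNoo] := eqVneq (\int[mu]_(s in `[a, b]) (H s)%:E)%E +oo%E.
  by rewrite Hoo addey ?leey.
have intH : mu.-integrable `[a, b] (EFin \o H).
  apply/integrableP; split; first exact/measurable_EFinP/measurable_funTS.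
  under eq_integral do rewrite gee0_abs ?lee_fin//.
  by rewrite ltey.
(* Cutting [H] off outside the interval makes it integrable on the whole line, so that the primitive
   [G] has derivative [Hab] almost everywhere to the right of [a]. *)
pose Hab := H \_ `[a, b].
have Hab0 s : 0 <= Hab s by rewrite /Hab patchE; case: ifP.
have intHab : mu.-integrable setT (EFin \o Hab).
  by move: intH; rewrite integrable_mkcond// (restrict_EFin H).
pose G t := (\int[mu]_(s in `[a, t]) Hab s)%R.
pose F t := expR (- lam * (b - t)) * (w t - K / lam).
have F_ac : abs_cont a b F.
  by apply: abs_contM; [exact/abs_cont_expR/ltW|exact: abs_contBr].
have G_nd s t : a <= s -> s <= t -> t <= b -> G s <= G t.
  move=> as_ st tb; apply: fine_le.
  - by apply: integrable_fin_num => //; exact: integrableS intHab.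
  - by apply: integrable_fin_num => //; exact: integrableS intHab.
  - apply: ge0_subset_integral => //.
    + by apply: measurable_funTS; case/integrableP: intHab.
    + by move=> x _; rewrite lee_fin.
    + by apply: subset_itvl; rewrite bnd_simp.
have G' : \forall s \ae mu, a < s -> is_derive s 1 G (Hab s).
  have := @FTC1 R Hab (BLeft a); case=> //.
  - by move=> y; exact: integrableS intHab.
  - exact: integrable_locally.
  - move=> N [mN N0 Nsub]; exists N; split => // s /= nGs; apply: Nsub => /= Gs.
    apply: nGs => as_; have [|dG <-] := Gs; first by rewrite lte_fin.
    by rewrite derive1E; exact: derivableP.
have FG : F b - F a <= G b - G a.
  have good : \forall s \ae mu, (a < s -> is_derive s 1 G (Hab s)) /\
      (a <= s -> s <= b ->
       derivable w s 1 /\ derive1 w s <= - lam * w s + h s + K).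
    have ae_mu := ae_filter_ringOfSetsType (@lebesgue_measure R).
    by apply: filterS2 G' w'_le => s.
  (* The point [a] joins the exceptional set, as the derivative of [G] is known only for [s > a]. *)
  apply: (abs_cont_le_growth ab F_ac G_nd (negligibleU good _)) => //.
    by apply/(@negligibleP _ _ _ mu [set a]) => //; exact: lebesgue_measure_set1.
  move=> s as_ sb /not_orP[/contrapT[Gs ws] /eqP sa] e e0.
  have as' : a < s by rewrite lt_neqAle eq_sym sa.
  have {}Gs := Gs as'; have [dw w's] := ws as_ (ltW sb).
  have w_der : is_derive s 1 w (derive1 w s).
    by rewrite derive1E; exact: derivableP.
  (* Differentiating the exponential contributes [lam * (w s - K / lam)], that is [lam * w s - K]:
     the shift was chosen to produce this [- K]. *)
  have F_der : is_derive s 1 F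
      (expR (- lam * (b - s)) * (derive1 w s + lam * w s - K)).
    have e_der : is_derive s 1 (fun t => expR (- lam * (b - t)))
        (expR (- lam * (b - s)) * lam).
      apply: is_derive1_comp.
      by apply: is_derive_eq; rewrite /GRing.scale/=; ring.
    apply: (is_derive_eq
      (is_deriveM e_der (is_deriveB w_der (is_derive_cst (K / lam) s 1)))).
    have KE : (K / lam) * lam = K by rewrite divfK// gt_eqF.
    by rewrite subr0 /GRing.scale/= -[(w - _) s]/(w s - K / lam) -[in RHS]KE; ring.
  have FG_der := is_deriveB F_der Gs.
  have : expR (- lam * (b - s)) * (derive1 w s + lam * w s - K) - Hab s <= 0.
    rewrite /Hab patchE mem_set/= ?in_itv/= ?as_ ?(ltW sb)//.
    rewrite /H -mulrBr pmulr_rle0 ?expR_gt0//; lra.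
  move=> /(is_derive_near_right_le FG_der)/(_ e0); apply: filterS => t.
  rewrite -[(F - G) t]/(F t - G t) -[(F - G) s]/(F s - G s); lra.
have Ga : G a = 0.
  by rewrite /G /Rintegral set_itv1 integral_set1.
have Gb : (G b)%:E = (\int[mu]_(s in `[a, b]) (H s)%:E)%E.
  rewrite /G /Rintegral fineK; last first.
    by apply: integrable_fin_num => //; exact: integrableS intHab.
  apply: eq_integral => s sab; congr EFin.
  by rewrite /Hab patchE sab.
rewrite -/mu -/(H _) -Gb -EFinD lee_fin.
move: FG; rewrite Ga /F subrr mulr0 expR0 mul1r; lra.
Qed.

(** * From Lebesgue-measurable to Borel functions *)

Lemma negligible_bigcup_countable (R : realType) d (T : sigmaRingType d)
    (mu : {measure set T -> \bar R}) (I : countType) (F : I -> set T) :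
  (forall i, mu.-negligible (F i)) -> mu.-negligible (\bigcup_i F i).
Proof.
move=> F0; pose G n := if unpickle n is Some i then F i else set0.
apply: (@negligibleS _ _ _ _ (\bigcup_n G n)).
  by move=> x [i _ Fix]; exists (pickle i) => //; rewrite /G pickleK.
apply: negligible_bigcup => n; rewrite /G; case: unpickle => //.
exact: negligible_set0.
Qed.

(** For rational [q], the part of [D] where [g > q] is a Borel set up to a null set. The countably
    many null sets are collected in one Borel null set [N], off which rational levels determine all
    the others. *)
Lemma lebesgue_measurable_fun_borel (R : realType) (D : set R) (g : R -> R) :
  measurable D -> lebesgue_measurable_fun D g ->
  exists N, [/\ measurable N, @lebesgue_measure R N = 0 & measurable_fun (D `\` N) g].
Proof.
move=> mD mg.
have mD' : (completed_algebra_gen (@lebesgue_measure R)).-sigma.-measurable D.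
  rewrite g_sigma_completed_algebra_genE; exists D => //; exists set0.
    exact: negligible_set0.
  by rewrite setU0.
have dec (q : rat) : exists A N0, [/\ measurable A, (@lebesgue_measure R).-negligible N0 &
    A `|` N0 = D `&` g @^-1` `]ratr q, +oo[].
  have := mg mD' `]ratr q, +oo[%classic (measurable_itv _).
  rewrite [X in X -> _](_ : _ =
    (completed_algebra_gen (@lebesgue_measure R)).-sigma.-measurable
      (D `&` g @^-1` `]ratr q, +oo[))//.
  rewrite g_sigma_completed_algebra_genE => -[A mA [N0 N00 eqA]].
  by exists A, N0.
have {dec} [A /choice[N0 AN]] := choice dec.
have [N [mN N_0 N0N]] : (@lebesgue_measure R).-negligible (\bigcup_q N0 q).
  by apply: negligible_bigcup_countable => q; have [] := AN q.
exists N; split => //.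
move=> mDN; apply: (measurability _ (RGenOInfty.measurableE R)) => //.
move=> /= _ [_ [y ->] <-].
(* A value exceeds [y] exactly when it exceeds some rational [q > y]. *)
rewrite [X in measurable X](_ : _ =
    \bigcup_(q : rat) (if y < ratr q then A q `\` N else set0)); last first.
  apply/seteqP; split => [x [[Dx Nx]]|x [q _]].
    rewrite /= in_itv/= andbT => /rat_in_itvoo[q]; rewrite in_itv/= => /andP[yq qx].
    exists q => //; rewrite yq; split => //.
    have [_ _ /seteqP[_ /(_ x)]] := AN q.
    rewrite /= in_itv/= andbT => /(_ (conj Dx qx))[//|N0x].
    by exfalso; apply/Nx/N0N; exists q.
  case: ifPn => // yq [Ax Nx]; have [_ _ /seteqP[/(_ x) + _]] := AN q.
  rewrite /= in_itv/= andbT => /(_ (or_introl Ax))[Dx qx]; split => //.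
  by rewrite /= in_itv/= andbT (lt_trans yq).
apply: bigcupT_measurable_rat => q; case: ifP => // _.
by apply: measurableD => //; have [] := AN q.
Qed.

(* Unlike [ge0_le_integral], no measurability is required: this is needed for the
   Lebesgue-measurable integrands of the theorem, which need not be Borel. *)
Lemma integral_le_nonneg (R : realType) d (T : measurableType d)
    (mu : {measure set T -> \bar R}) (D : set T) (f g : T -> \bar R) :
  (forall x, D x -> 0 <= f x)%E -> (forall x, D x -> f x <= g x)%E ->
  (\int[mu]_(x in D) f x <= \int[mu]_(x in D) g x)%E.
Proof.
move=> f0 fg; rewrite !ge0_integralE//; last first.
  by move=> x Dx; exact: le_trans (f0 _ Dx) (fg _ Dx).
apply: le_ereal_sup => _ [h hf <-]; exists h => // x; apply: le_trans (hf x) _.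
rewrite !patchE; case: ifPn => // xD; apply: fg; exact: set_mem.
Qed.

(** * Powers and p-th roots of sums *)

(** Write (x + y)^p as x (x + y)^(p-1) + y (x + y)^(p-1) and use that the power p - 1 >= 0 is
    monotone. *)
Lemma powR_superadditive (R : realType) (p x y : R) : 1 <= p -> 0 <= x -> 0 <= y ->
  x `^ p + y `^ p <= (x + y) `^ p.
Proof.
move=> p1 x0 y0; have p0 : 0 < p by exact: lt_le_trans p1.
rewrite -!(mulr_powRB1 _ p0) ?addr_ge0// mulrDl.
by apply: lerD; apply: ler_wpM2l => //; apply: ge0_ler_powR;
  rewrite ?subr_ge0 ?nnegrE ?addr_ge0 ?lerDl ?lerDr.
Qed.

(** The sum is at most twice the larger term. This serves to show that the p-th power of [vE + rho]
    is integrable. *)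
Lemma powRD_le (R : realType) (p x y : R) : 0 <= p -> 0 <= x -> 0 <= y ->
  (x + y) `^ p <= 2 `^ p * (x `^ p + y `^ p).
Proof.
move=> p0; wlog xy : x y / x <= y => [hw x0 y0|x0 y0].
  by have [/hw->//|/ltW/hw yx] := leP x y; rewrite addrC [in leRHS]addrC yx.
apply: (@le_trans _ _ ((2 * y) `^ p)).
  by apply: ge0_ler_powR; rewrite ?nnegrE ?addr_ge0 ?mulr_ge0//; lra.
by rewrite powRM// ler_wpM2l ?powR_ge0// lerDr powR_ge0.
Qed.

Lemma powR_root (R : realType) (p x : R) : 0 < p -> 0 <= x -> (x `^ p^-1) `^ p = x.
Proof. by move=> p0 x0; rewrite -powRrM mulVf ?gt_eqF// powRr1. Qed.

(** By superadditivity, the p-th power of the claimed bound dominates the sum of the p-th powers of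
    its three terms, which is the right-hand side of the hypothesis divided by [m]. In the
    applications [I] stands for an integral or a p-th power, and [U] for the sup norm of the
    input. *)
Lemma powR_le_root_sum (R : realType) (p m M c k d d0 I U : R) :
  1 <= p -> 0 < m -> 0 <= M -> 0 <= c -> 0 <= k -> 0 <= d -> 0 <= d0 -> 0 <= I ->
  0 <= U -> m * d `^ p <= M * d0 `^ p + c * I + k * U `^ p ->
  d <= (M / m) `^ p^-1 * d0 + (c / m) `^ p^-1 * I `^ p^-1 + (k / m) `^ p^-1 * U.
Proof.
move=> p1 m0 M0 c0 k0 d0_ge0 d00 I0 U0 le_md.
have p0 : 0 < p by exact: lt_le_trans p1.
have Mm : 0 <= M / m by rewrite divr_ge0// ltW.
have cm : 0 <= c / m by rewrite divr_ge0// ltW.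
have km : 0 <= k / m by rewrite divr_ge0// ltW.
set rhs := leRHS.
rewrite leNgt; apply/negP => rhs_lt.
have : rhs `^ p < d `^ p.
  by apply: gt0_ltr_powR => //; rewrite nnegrE// ?addr_ge0 ?mulr_ge0 ?powR_ge0.
apply/negP; rewrite -leNgt.
apply: (@le_trans _ _ ((M * d0 `^ p + c * I + k * U `^ p) / m)).
  by rewrite ler_pdivlMr// mulrC.
rewrite /rhs; apply: le_trans (powR_superadditive p1 _ _); last 2 first.
- by rewrite addr_ge0 ?mulr_ge0 ?powR_ge0.
- by rewrite mulr_ge0 ?powR_ge0.
have := @powR_superadditive R p ((M / m) `^ p^-1 * d0) ((c / m) `^ p^-1 * I `^ p^-1) p1.
rewrite !mulr_ge0 ?powR_ge0// => /(_ isT isT).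
rewrite -(lerD2r (((k / m) `^ p^-1 * U) `^ p)); apply: le_trans.
rewrite (powRM _ (powR_ge0 (M / m) _) d00).
rewrite (powRM _ (powR_ge0 (c / m) _) (powR_ge0 I _)).
rewrite (powRM _ (powR_ge0 (k / m) _) U0) !powR_root//.
by rewrite le_eqVlt; apply/orP; left; apply/eqP; field; rewrite gt_eqF.
Qed.

(** * Norms, distances and Lebesgue spaces *)

Lemma enorm_ge0 (R : realType) (n : nat) (x : 'rV[R]_n) : 0 <= enorm x.
Proof. exact: sqrtr_ge0. Qed.

Lemma dist_ge0 (R : realType) (n : nat) (x : 'rV[R]_n) (S : set 'rV[R]_n) :
  S !=set0 -> 0 <= dist x S.
Proof.
move=> [y Sy]; apply: lb_le_inf; first by exists (enorm (x - y)), y.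
by move=> _ [z _ <-]; exact: enorm_ge0.
Qed.

Lemma measurable_enorm (R : realType) (n : nat) (D : set R) (u : R -> 'rV[R]_n) :
  (forall i, measurable_fun D (fun s => u s ord0 i)) ->
  measurable_fun D (fun s => enorm (u s)).
Proof.
move=> mu; apply: (@measurableT_comp _ _ _ _ _ _ (@Num.sqrt R)).
  by apply: continuous_measurable_fun; exact: sqrt_continuous.
by apply: measurable_sum => i; apply: measurable_funX.
Qed.

(** Selects the essential supremum in the norm of exponent [+oo], which is defined by cases on the
    measure of the whole space. *)
Lemma lebesgue_measureT_gt0 (R : realType) : (0 < @lebesgue_measure R setT)%E.
Proof. by rewrite -set_itvNyy lebesgue_measure_itv/= addey ?ltry. Qed.

Lemma Lp_norm_ge0 (R : realType) (D : set R) p (g : R -> R) : (0 <= Lp_norm D p g)%E.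
Proof. exact: Lnorm_ge0. Qed.

Lemma in_Linfty_ae_le (R : realType) (D : set R) (g : R -> R) :
  (Lp_norm D +oo g < +oo)%E ->
  \forall s \ae (@lebesgue_measure R), D s -> `|g s| <= fine (Lp_norm D +oo g).
Proof.
move=> goo; have : Lp_norm D +oo g \is a fin_num by rewrite ge0_fin_numE ?Lp_norm_ge0.
move: goo; rewrite /Lp_norm unlock lebesgue_measureT_gt0 => _ gfin.
have ae_mu := ae_filter_ringOfSetsType (@lebesgue_measure R).
have := ess_sup_ge (@lebesgue_measure R) (abse \o (EFin \o g) \_ D).
rewrite -(fineK gfin); apply: filterS => s + Ds.
by rewrite /= patchE mem_set// lee_fin.
Qed.

Lemma in_Lp_integral_lty (R : realType) (D A : set R) (p : R) (g : R -> R) :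
  1 <= p -> A `<=` D -> (Lp_norm D p%:E g < +oo)%E ->
  (\int[@lebesgue_measure R]_(s in A) (`|g s| `^ p)%:E < +oo)%E.
Proof.
move=> p1 AD; have p0 : p != 0 by rewrite gt_eqF// (lt_le_trans _ p1).
rewrite /Lp_norm unlock => /lty_poweRy; rewrite invr_eq0 => /(_ p0).
apply: le_lt_trans; rewrite [X in (X <= _)%E]integral_mkcond.
apply: integral_le_nonneg => s _.
  by rewrite patchE; case: ifP => // _; rewrite lee_fin powR_ge0.
rewrite !patchE; case: ifPn => [/set_mem/AD/mem_set->//|_].
exact: poweR_ge0.
Qed.

(** A common null set is what lets sums and norms built from the family be Borel off it as well. *)
Lemma lebesgue_measurable_fun_borel_family (R : realType) (I : countType) (D : set R)
    (g : I -> R -> R) :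
  measurable D -> (forall i, lebesgue_measurable_fun D (g i)) ->
  exists N, [/\ measurable N, @lebesgue_measure R N = 0 &
    forall i, measurable_fun (D `\` N) (g i)].
Proof.
move=> mD mg.
have /choice[N0 gN0] i := lebesgue_measurable_fun_borel mD (mg i).
have [N [mN N_0 N0N]] : (@lebesgue_measure R).-negligible (\bigcup_i N0 i).
  apply: negligible_bigcup_countable => i; have [mN0i N0i _] := gN0 i.
  by exists (N0 i); split.
exists N; split => // i; have [mN0i _ mgi] := gN0 i.
apply: measurable_funS mgi; first exact: (measurableD mD mN0i).
by apply: setDS => s N0s; apply: N0N; exists i.
Qed.

Lemma null_ae_notin (R : realType) (N : set R) :
  measurable N -> @lebesgue_measure R N = 0 ->
  \forall s \ae (@lebesgue_measure R), ~ N s.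
Proof. by move=> mN N0; exists N; split => // s /= /contrapT. Qed.

(** * The estimate at each time *)

(** For [K >= 0] the shift by [K / lam] at the initial time only helps and is dropped. *)
Lemma gronwall_ge0 (R : realType) (a b lam K : R) (w h : R -> R) :
  a <= b -> 0 < lam -> 0 <= K -> abs_cont a b w -> measurable_fun setT h ->
  (forall s, 0 <= h s) ->
  (\forall s \ae (@lebesgue_measure R), a <= s -> s <= b -> derivable w s 1 /\
     derive1 w s <= - lam * w s + h s + K) ->
  ((w b)%:E <= (expR (- lam * (b - a)) * w a + K / lam)%:E +
    \int[lebesgue_measure]_(s in `[a, b]) (expR (- lam * (b - s)) * h s)%:E)%E.
Proof.
move=> ab lam0 K0 w_ac mh h0 /(gronwall ab lam0 w_ac mh h0).
rewrite EFinB leeBlDr// => /le_trans; apply.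
rewrite addeAC leeD2r// -EFinD lee_fin mulrBr -addrA lerD2l gerDr oppr_le0.
by rewrite mulr_ge0 ?expR_ge0// divr_ge0// ltW.
Qed.

Lemma pointwise_estimate (R : realType) (p m M c cu lam C t0 t : R)
    (vE rho nu w d : R -> R) :
  1 <= p -> 0 < m -> 0 <= M -> 0 <= c -> 0 <= cu -> 0 < lam -> 0 < C ->
  (M / m) `^ p^-1 <= C -> (c / m) `^ p^-1 <= C -> (cu / lam / m) `^ p^-1 <= C ->
  t0 <= t -> abs_cont t0 t w ->
  lebesgue_measurable_fun `[t0, t] vE -> lebesgue_measurable_fun `[t0, t] rho ->
  (forall s, 0 <= nu s) -> 0 <= d t0 -> 0 <= d t ->
  m * d t `^ p <= w t -> w t0 <= M * d t0 `^ p ->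
  (\forall s \ae (@lebesgue_measure R), t0 <= s -> derivable w s 1 /\
    derive1 w s <= - lam * w s + c * (vE s + rho s) `^ p + cu * nu s `^ p) ->
  ((d t)%:E <= (C * expR (- lam * (t - t0) / p) * d t0)%:E
    + C%:E * (\int[lebesgue_measure]_(s in `[t0, t])
        (expR (- lam * (t - s)) * (vE s + rho s) `^ p)%:E) `^ p^-1
    + C%:E * Lp_norm `]t0, t[ +oo%E nu)%E.
Proof.
move=> p1 m0 M0 c0 cu0 lam0 C0 MC cC cuC t0t w_ac mvE mrho nu0 dt0 dt mdw wMd w'_le.
have p0 : 0 < p by exact: lt_le_trans p1.
set mu := @lebesgue_measure R in w'_le *.
set J := (\int[mu]_(s in _) _)%E; set N := Lp_norm _ _ _.
have J0 : (0 <= J)%E.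
  by apply: integral_ge0 => s _; rewrite lee_fin mulr_ge0 ?expR_ge0 ?powR_ge0.
have N0 : (0 <= N)%E by exact: Lp_norm_ge0.
have first0 : (0 <= (C * expR (- lam * (t - t0) / p) * d t0)%:E)%E.
  by rewrite lee_fin !mulr_ge0 ?expR_ge0// ltW.
(* If the integral or the norm is infinite, the right-hand side is [+oo]; the remaining argument is
   about real numbers. *)
have [Joo|Jfin] := eqVneq J +oo%E.
  rewrite Joo poweRyr ?invr_eq0 ?gt_eqF// gt0_muley ?lte_fin// addey ?gt_eqF//.
    by rewrite addye ?leey// gt_eqF// (lt_le_trans (ltNyr 0))// mule_ge0// lee_fin ltW.
  by rewrite (lt_le_trans (ltNyr 0)).
have [Noo|Nfin] := eqVneq N +oo%E.
  rewrite Noo gt0_muley ?lte_fin// addey ?leey// gt_eqF//.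
  by rewrite (lt_le_trans (ltNyr 0))// adde_ge0// mule_ge0// ?poweR_ge0// lee_fin ltW.
have Nlt : (N < +oo)%E by rewrite ltey.
have nuN := in_Linfty_ae_le Nlt.
have {}Jfin : J \is a fin_num by rewrite ge0_fin_numE// ltey.
have {}Nfin : N \is a fin_num by rewrite ge0_fin_numE.
have fJ0 : 0 <= fine J by exact: fine_ge0.
have fN0 : 0 <= fine N by exact: fine_ge0.
have [|Z [mZ Z0 mg]] := @lebesgue_measurable_fun_borel_family _ bool `[t0, t]
  (fun b => if b then vE else rho) (measurable_itv _).
  by case.
pose A : set R := `[t0, t] `\` Z.
have mA : measurable A by exact: measurableD.
(* The forcing is set to 0 on the null set [Z] and outside the interval: this makes [h] Borel on the
   line and preserves the differential inequality almost everywhere. *)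
pose k s := (vE s + rho s) `^ p.
pose h := (fun s => c * k s) \_ A.
have mh : measurable_fun setT h.
  apply/(measurable_restrictT _ _).1 => //.
  apply: measurable_funM => //.
  apply: (measurableT_comp (measurable_powR _)).
  by apply: measurable_funD; [exact: (mg true)|exact: (mg false)].
have h0 s : 0 <= h s.
  by rewrite /h patchE; case: ifP => // _; rewrite mulr_ge0 ?powR_ge0.
pose K := cu * fine N `^ p.
have K0 : 0 <= K by rewrite mulr_ge0 ?powR_ge0.
have wt : ((w t)%:E <= (expR (- lam * (t - t0)) * w t0 + K / lam)%:E +
    \int[mu]_(s in `[t0, t]) (expR (- lam * (t - s)) * h s)%:E)%E.
  apply: gronwall_ge0 => //.
  have ae_mu := ae_filter_ringOfSetsType (@lebesgue_measure R).
  (* The norm of [nu] is over the open interval, so both endpoints are discarded as null sets. *)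
  have nt0 : \forall s \ae mu, s != t0.
    apply: filterS (null_ae_notin (measurable_set1 t0) (lebesgue_measure_set1 t0)).
    by move=> s /= /eqP.
  have nt : \forall s \ae mu, s != t.
    apply: filterS (null_ae_notin (measurable_set1 t) (lebesgue_measure_set1 t)).
    by move=> s /= /eqP.
  have nZ := null_ae_notin mZ Z0.
  have nt0t : \forall s \ae mu, s != t0 /\ s != t /\ ~ Z s.
    by apply: filterS3 nt0 nt nZ => s.
  apply: filterS3 w'_le nuN nt0t => s + + [st0 [st nZs]] t0s st_le.
  move=> /(_ t0s)[dw w's].
  rewrite /= in_itv/= !lt_neqAle t0s st_le st eq_sym st0 => /(_ isT) nus.
  split => //; apply: le_trans w's _.
  rewrite /h patchE mem_set/=; last by split => //; rewrite /= in_itv/= t0s.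
  rewrite lerD2l ler_wpM2l// ge0_ler_powR ?nnegrE// ?(le_trans zero_le_one p1)//.
    by rewrite (le_trans ler01).
  by rewrite (le_trans _ nus)// ler_norm.
(* Cutting [k] off can only lower the integral. The integrand of [J] itself may fail to be Borel,
   hence the use of [integral_le_nonneg]. *)
have hJ : (\int[mu]_(s in `[t0, t]) (expR (- lam * (t - s)) * h s)%:E <= c%:E * J)%E.
  rewrite [X in (X <= _)%E](_ : _ = \int[mu]_(s in `[t0, t])
      (c%:E * (expR (- lam * (t - s)) * (k \_ A) s)%:E))%E; last first.
    apply: eq_integral => s _; rewrite -EFinM mulrCA; congr (EFin (_ * _)).
    by rewrite /h !patchE; case: ifP => //; rewrite mulr0.
  rewrite ge0_integralZl_EFin//; last 2 first.
  - move=> s _; rewrite lee_fin mulr_ge0 ?expR_ge0// patchE.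
    by case: ifP; rewrite ?powR_ge0.
  - apply/measurable_EFinP/measurable_funTS; apply: measurable_funM.
      apply: measurableT_comp => //.
      by apply: measurable_funM => //; exact: measurable_funB.
    apply/(measurable_restrictT _ _).1 => //.
    apply: (measurableT_comp (measurable_powR _)).
    by apply: measurable_funD; [exact: (mg true)|exact: (mg false)].
  apply: lee_wpmul2l; first by rewrite lee_fin.
  apply: integral_le_nonneg => s _; rewrite lee_fin.
    by rewrite mulr_ge0 ?expR_ge0// patchE; case: ifP; rewrite ?powR_ge0.
  by rewrite ler_wpM2l ?expR_ge0// patchE; case: ifP; rewrite ?powR_ge0.
move: wt => /le_trans/(_ (leeD2l _ hJ)).
rewrite -(fineK Jfin) -(fineK Nfin) poweR_EFin -!EFinM -!EFinD !lee_fin => wt.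
(* The p-th root of the decay factor, so that the initial term becomes [M] times the p-th power of
   [e * d t0]. *)
pose e := expR (- lam * (t - t0) / p).
have eE : expR (- lam * (t - t0)) = e `^ p.
  by rewrite -expRM divfK// gt_eqF.
have e0 : 0 <= e by exact: expR_ge0.
have : m * d t `^ p <= M * (e * d t0) `^ p + c * fine J + cu / lam * fine N `^ p.
  apply: (le_trans mdw); apply: (le_trans wt).
  rewrite addrAC [cu / lam * _]mulrAC lerD2r lerD2r eE powRM// mulrCA.
  by rewrite ler_wpM2l ?powR_ge0.
move=> /powR_le_root_sum; rewrite divr_ge0 ?mulr_ge0 ?(ltW lam0)//.
move=> /(_ p1 m0 M0 c0 isT dt isT fJ0 fN0) /le_trans; apply.
rewrite -!(mulrA C); apply: lerD; [apply: lerD|];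
  by rewrite ler_wpM2r ?mulr_ge0 ?powR_ge0.
Qed.

(** * The bound on the upper limit *)

(** Since 1 + k (t - t0) <= e^(k (t - t0)), it suffices that [t] exceed an explicit threshold. *)
Lemma expR_decay (R : realType) (k t0 B e : R) : 0 < k -> 0 < e ->
  \forall t \near +oo, B * expR (- k * (t - t0)) <= e.
Proof.
move=> k0 e0; near=> t.
have B0 : 0 < `|B| + 1 by rewrite ltr_wpDl.
rewrite (@le_trans _ _ ((`|B| + 1) * expR (- k * (t - t0))))//.
  by rewrite ler_wpM2r ?expR_ge0// ler_wpDr// ler_norm.
rewrite -ler_pdivlMl// [leRHS]mulrC.
have -> : - k * (t - t0) = - (k * (t - t0)) by ring.
rewrite expRN -[leRHS]invrK lef_pV2 ?posrE ?expR_gt0 ?invr_gt0 ?divr_gt0//.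
rewrite (le_trans _ (expR_ge1Dx _))// -lerBlDl -ler_pdivrMl// mulrC -lerBlDr opprK.
near: t; apply: nbhs_pinfty_ge; exact: num_real.
Unshelve. all: by end_near. Qed.

Lemma limsup_estimate (R : realType) (p m M c cu lam C t0 : R)
    (vE rho nu w d : R -> R) :
  1 <= p -> 0 < m -> 0 <= M -> 0 <= c -> 0 <= cu -> 0 < lam -> 0 < C ->
  (c / lam / m) `^ p^-1 <= C -> (cu / lam / m) `^ p^-1 <= C ->
  (forall t, t0 <= t -> abs_cont t0 t w) ->
  (\forall s \ae (@lebesgue_measure R), t0 <= s -> 0 <= vE s) ->
  (\forall s \ae (@lebesgue_measure R), t0 <= s -> 0 <= rho s) ->
  (forall s, 0 <= nu s) -> (forall t, t0 <= t -> 0 <= d t) ->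
  (forall t, t0 <= t -> m * d t `^ p <= w t /\ w t <= M * d t `^ p) ->
  (\forall s \ae (@lebesgue_measure R), t0 <= s -> derivable w s 1 /\
    derive1 w s <= - lam * w s + c * (vE s + rho s) `^ p + cu * nu s `^ p) ->
  (Lp_norm `[t0, +oo[ +oo vE < +oo)%E -> (Lp_norm `[t0, +oo[ +oo rho < +oo)%E ->
  (Lp_norm `[t0, +oo[ +oo nu < +oo)%E ->
  (limf_esup (fun t => (d t)%:E) (pinfty_nbhs R) <=
   C%:E * (Lp_norm `[t0, +oo[ +oo vE + Lp_norm `[t0, +oo[ +oo rho
           + Lp_norm `[t0, +oo[ +oo nu))%E.
Proof.
move=> p1 m0 M0 c0 cu0 lam0 C0 cC cuC w_ac vE0 rho0 nu0 d0 wd w'_le vEoo rhooo nuoo.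
have p0 : 0 < p by exact: lt_le_trans p1.
have vEA := in_Linfty_ae_le vEoo.
have rhoB := in_Linfty_ae_le rhooo.
have nuU := in_Linfty_ae_le nuoo.
have norm_fin g : (Lp_norm `[t0, +oo[ +oo g < +oo)%E ->
    Lp_norm `[t0, +oo[ +oo g = (fine (Lp_norm `[t0, +oo[ +oo g))%:E.
  by move=> goo; rewrite fineK// ge0_fin_numE// Lp_norm_ge0.
have norm_ge0 g : 0 <= fine (Lp_norm `[t0, +oo[ +oo g).
  by apply: fine_ge0; exact: Lp_norm_ge0.
rewrite (norm_fin _ vEoo) (norm_fin _ rhooo) (norm_fin _ nuoo).
set A := fine (Lp_norm _ _ vE) in vEA *; set B := fine (Lp_norm _ _ rho) in rhoB *.
set U := fine (Lp_norm _ _ nu) in nuU *.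
have A0 : 0 <= A by exact: norm_ge0.
have B0 : 0 <= B by exact: norm_ge0.
have U0 : 0 <= U by exact: norm_ge0.
(* The sup norms bound the whole forcing by this constant almost everywhere, so the Gronwall
   estimate applies with [h = 0]. *)
pose K := c * (A + B) `^ p + cu * U `^ p.
have K0 : 0 <= K by rewrite addr_ge0// mulr_ge0 ?powR_ge0.
have w_le t : t0 <= t -> w t <= expR (- lam * (t - t0)) * w t0 + K / lam.
  move=> t0t.
  have := @gronwall_ge0 R t0 t lam K w (cst 0) t0t lam0 K0 (w_ac t t0t).
  under eq_integral do rewrite /= mulr0.
  rewrite integral0 adde0 lee_fin; apply => //.
  have ae_mu := ae_filter_ringOfSetsType (@lebesgue_measure R).
  have vE_ae : \forall s \ae (@lebesgue_measure R), t0 <= s -> 0 <= vE s <= A.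
    apply: filterS2 vE0 vEA => s /= + + t0s.
    rewrite in_itv/= t0s => /(_ isT)-> /(_ isT); exact: le_trans (ler_norm _).
  have rho_ae : \forall s \ae (@lebesgue_measure R), t0 <= s -> 0 <= rho s <= B.
    apply: filterS2 rho0 rhoB => s /= + + t0s.
    rewrite in_itv/= t0s => /(_ isT)-> /(_ isT); exact: le_trans (ler_norm _).
  have vErho_ae : \forall s \ae (@lebesgue_measure R), t0 <= s ->
      0 <= vE s + rho s <= A + B.
    apply: filterS2 vE_ae rho_ae => s /= + + t0s.
    by move=> /(_ t0s)/andP[? ?] /(_ t0s)/andP[? ?]; rewrite addr_ge0// lerD.
  apply: filterS3 w'_le vErho_ae nuU => s /= + + + t0s _.
  move=> /(_ t0s)[dw w's] /(_ t0s)/andP[vr0 vrAB].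
  rewrite in_itv/= t0s => /(_ isT) nuU'.
  split => //; apply: le_trans w's _.
  rewrite addr0 -addrA lerD2l /K; apply: lerD; apply: ler_wpM2l => //.
    apply: (ge0_ler_powR (ltW p0)); rewrite ?nnegrE//.
    exact: addr_ge0.
  apply: (ge0_ler_powR (ltW p0)); rewrite ?nnegrE//.
  exact: le_trans (ler_norm _) _.
pose D0 := (M / m) `^ p^-1 * d t0.
have d_le t : t0 <= t -> d t <= D0 * expR (- (lam / p) * (t - t0)) + C * (A + B + U).
  move=> t0t.
  pose e := expR (- (lam / p) * (t - t0)).
  have eE : expR (- lam * (t - t0)) = e `^ p.
    by rewrite -expRM; congr expR; field; rewrite gt_eqF.
  have e0 : 0 <= e by exact: expR_ge0.
  have : m * d t `^ p <= M * (e * d t0) `^ p + c / lam * (A + B) `^ p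
      + cu / lam * U `^ p.
    apply: (le_trans (wd t t0t).1); apply: (le_trans (w_le t t0t)).
    rewrite -addrA lerD//; last first.
      by rewrite /K le_eqVlt; apply/orP; left; apply/eqP; field; rewrite gt_eqF.
    rewrite eE powRM ?d0// mulrCA ler_wpM2l ?powR_ge0//.
    exact: (wd t0 (lexx _)).2.
  have d00 : 0 <= d t0 by exact: d0.
  have lc0 : 0 <= c / lam by rewrite divr_ge0// ltW.
  have lcu0 : 0 <= cu / lam by rewrite divr_ge0// ltW.
  (* The role of [I] is played by the p-th power of [A + B], whose root gives back [A + B]. *)
  move=> /(powR_le_root_sum p1 m0 M0 lc0 lcu0 (d0 t t0t) (mulr_ge0 e0 d00)
    (powR_ge0 _ _) U0) /le_trans; apply.
  rewrite -powRrM divff ?gt_eqF// powRr1 ?addr_ge0// -addrA lerD//.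
    by rewrite /D0 mulrAC -mulrA.
  by rewrite [leRHS]mulrDr; apply: lerD; apply: ler_wpM2r => //; exact: addr_ge0.
apply/lee_addgt0Pr => eta eta0.
have lp0 : 0 < lam / p by rewrite divr_gt0.
have decay := expR_decay t0 D0 lp0 eta0.
have t0_oo : \forall t \near +oo, t0 <= t by apply: nbhs_pinfty_ge; exact: num_real.
(* The upper limit is an infimum of suprema over neighbourhoods of [+oo]; the one used consists of
   the times at which the decaying term is at most [eta]. *)
apply: ge_ereal_inf; exists (ereal_sup ((fun t => (d t)%:E) @` 
    [set t | t0 <= t /\ D0 * expR (- (lam / p) * (t - t0)) <= eta])).
  exists [set t | t0 <= t /\ D0 * expR (- (lam / p) * (t - t0)) <= eta] => //.
  by apply: filterS2 t0_oo decay => t.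
apply: ge_ereal_sup => _ [t [t0t etat] <-].
rewrite -[leRHS]/((C * (A + B + U) + eta)%:E) lee_fin (le_trans (d_le t t0t))// addrC.
by rewrite lerD2l.
Qed.

(** * Convergence to zero for p-integrable data *)

(** The integrals [J t] from [t0] are bounded by the total integral. Once [J s] is within [e] of
    their supremum, no later [J t] exceeds it by more than [e]. *)
Lemma integral_itv_tail (R : realType) (t0 e : R) (h : R -> R) :
  0 < e -> (forall s, 0 <= h s) ->
  (@lebesgue_measure R).-integrable setT (EFin \o h) ->
  exists2 s, t0 <= s & forall t, s <= t ->
    (\int[lebesgue_measure]_(x in `[s, t]) (h x)%:E <= e%:E)%E.
Proof.
move=> e0 h0 inth; have mh : measurable_fun setT (EFin \o h) by case/integrableP: inth.
have intfin B : measurable B ->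
    (\int[lebesgue_measure]_(x in B) (h x)%:E)%E \is a fin_num.
  by move=> mB; apply: integrable_fin_num => //; exact: integrableS inth.
pose J t := (\int[lebesgue_measure]_(x in `[t0, t]) h x)%R.
have J_sup : has_sup [set J t | t in [set t | t0 <= t]].
  split; first by exists (J t0), t0 => //=.
  exists (fine (\int[lebesgue_measure]_x (h x)%:E)) => _ [t _ <-].
  apply: fine_le; rewrite ?intfin//.
  by apply: ge0_subset_integral => // x _; rewrite lee_fin.
have [_ [s t0s <-] Js] := sup_adherent e0 J_sup; exists s => // t st.
have JE : (J t)%:E = ((J s)%:E + \int[lebesgue_measure]_(x in `[s, t]) (h x)%:E)%E.
  rewrite /J /Rintegral !fineK ?intfin//.
  rewrite -[X in (_ = X + _)%E]integral_itv_bndo_bndc; last exact: measurable_funTS.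
  have disj : [disjoint `[t0, s[%classic & `[s, t]%classic].
    apply/disj_setPLR => x /=; rewrite !in_itv/= => /andP[_ xs].
    by apply/negP; rewrite negb_and -ltNge xs.
  have tU : `[t0, t]%classic = `[t0, s[ `|` `[s, t].
    by rewrite -itv_bndbnd_setU// bnd_simp.
  rewrite tU; have := @ge0_integral_setU _ _ _ (@lebesgue_measure R)
    `[t0, s[%classic `[s, t]%classic
    (measurable_itv _) (measurable_itv _) (EFin \o h).
  move=> /(_ (measurable_funTS mh)); apply; last exact: disj.
  by move=> x _; rewrite /= lee_fin; exact: h0.
have [JtE] : (J t)%:E = (J s + fine (\int[lebesgue_measure]_(x in `[s, t]) (h x)%:E))%:E.
  by rewrite JE EFinD; congr (_ + _)%E; rewrite fineK// intfin.
rewrite -(fineK (intfin `[s, t]%classic _))// lee_fin.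
have : J t <= sup [set J t | t in [set t | t0 <= t]].
  by apply: ub_le_sup; [case: J_sup|exists t => //=; exact: le_trans st].
move: Js; rewrite JtE; lra.
Qed.

Lemma cvg0_estimate (R : realType) (n : nat) (p m c cu lam t0 : R)
    (vE rho w d : R -> R) (u : R -> 'rV[R]_n) :
  1 <= p -> 0 < m -> 0 <= c -> 0 <= cu -> 0 < lam ->
  (forall s t, t0 <= s -> s <= t -> abs_cont s t w) ->
  (\forall s \ae (@lebesgue_measure R), t0 <= s -> 0 <= vE s) ->
  (\forall s \ae (@lebesgue_measure R), t0 <= s -> 0 <= rho s) ->
  (forall t, t0 <= t -> 0 <= d t /\ m * d t `^ p <= w t) ->
  (\forall s \ae (@lebesgue_measure R), t0 <= s -> derivable w s 1 /\
    derive1 w s <= - lam * w s + c * (vE s + rho s) `^ p + cu * enorm (u s) `^ p) ->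
  in_Lp `[t0, +oo[ p%:E vE -> in_Lp `[t0, +oo[ p%:E rho ->
  in_vLp `[t0, +oo[ p%:E u ->
  d t @[t --> +oo] --> 0.
Proof.
move=> p1 m0 c0 cu0 lam0 w_ac vE0 rho0 dw w'_le [mvE vEp] [mrho rhop] [mu_ up].
have p0 : 0 < p by exact: lt_le_trans p1.
(* The index type is a sum: two indices for [vE] and [rho], and one for each coordinate of [u]. *)
have [|Z [mZ Z0 mg]] := @lebesgue_measurable_fun_borel_family _ (bool + 'I_n)%type
  `[t0, +oo[ (fun i => match i with
     | inl true => vE | inl false => rho | inr i => fun s => u s ord0 i end)
  (measurable_itv _).
  by move=> [[]|i].
pose A : set R := `[t0, +oo[ `\` Z.
have mA : measurable A by exact: measurableD.
have AD : A `<=` `[t0, +oo[ by exact: subDsetl.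
have m1 : measurable_fun A vE by exact: (mg (inl true)).
have m2 : measurable_fun A rho by exact: (mg (inl false)).
have m3 : measurable_fun A (fun s => enorm (u s)).
  by apply: measurable_enorm => i; exact: (mg (inr i)).
have m_normp (g : R -> R) : measurable_fun A g -> measurable_fun A (fun s => `|g s| `^ p).
  move=> mg'; apply: (measurableT_comp (measurable_powR p)).
  exact: measurableT_comp.
have int_normp (g : R -> R) : measurable_fun A g -> (Lp_norm `[t0, +oo[ p%:E g < +oo)%E ->
    (@lebesgue_measure R).-integrable A (fun s => (`|g s| `^ p)%:E).
  move=> mg' gp; apply/integrableP; split.
    by apply/measurable_EFinP; exact: m_normp.
  under eq_integral do rewrite gee0_abs ?lee_fin ?powR_ge0//.
  exact: in_Lp_integral_lty AD gp.
(* The absolute values make the integrability of [h] a matter of norms; almost everywhere after [t0]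
   they change nothing, by the sign of [vE] and [rho]. *)
pose h s := c * `|vE s + rho s| `^ p + cu * `|enorm (u s)| `^ p.
have h_ge0 s : 0 <= h s by rewrite addr_ge0 ?mulr_ge0 ?powR_ge0.
have mh : measurable_fun A h.
  by apply: measurable_funD; apply: measurable_funM => //;
    apply: m_normp => //; exact: measurable_funD.
have inth : (@lebesgue_measure R).-integrable A (EFin \o h).
  pose G := ((fun s => (c * 2 `^ p)%:E * ((`|vE s| `^ p)%:E + (`|rho s| `^ p)%:E))
    \+ (fun s => cu%:E * (`|enorm (u s)| `^ p)%:E))%E.
  have intG : (@lebesgue_measure R).-integrable A G.
    apply: integrableD => //; apply: integrableZl => //; last exact: int_normp.
    by apply: integrableD => //; exact: int_normp.
  apply: le_integrable intG => //; first exact/measurable_EFinP.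
  move=> s As.
  have -> : G s = (c * 2 `^ p * (`|vE s| `^ p + `|rho s| `^ p) +
    cu * `|enorm (u s)| `^ p)%:E by [].
  rewrite /= lee_fin (ger0_norm (h_ge0 s)) ger0_norm; last first.
    by rewrite addr_ge0// ?mulr_ge0// ?addr_ge0 ?powR_ge0.
  rewrite lerD2r -mulrA ler_wpM2l//.
  apply: le_trans (powRD_le (ltW p0) (normr_ge0 _) (normr_ge0 _)).
  by apply: (ge0_ler_powR (ltW p0)); rewrite ?nnegrE ?addr_ge0//; exact: ler_normD.
pose hA := h \_ A.
have hA0 s : 0 <= hA s by rewrite /hA patchE; case: ifP.
have inthA : (@lebesgue_measure R).-integrable setT (EFin \o hA).
  by move: inth; rewrite integrable_mkcond// (restrict_EFin h).
have mhA : measurable_fun setT hA by case/integrableP: inthA => /measurable_EFinP.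
have w'_hA : \forall s \ae (@lebesgue_measure R), t0 <= s -> derivable w s 1 /\
    derive1 w s <= - lam * w s + hA s + 0.
  have ae_mu := ae_filter_ringOfSetsType (@lebesgue_measure R).
  have vr0 : \forall s \ae (@lebesgue_measure R), t0 <= s -> 0 <= vE s + rho s.
    by apply: filterS2 vE0 rho0 => s /= + + t0s => /(_ t0s)? /(_ t0s)?; exact: addr_ge0.
  apply: filterS3 w'_le vr0 (null_ae_notin mZ Z0) => s /= + + nZs t0s.
  move=> /(_ t0s)[dws w's] /(_ t0s) vrs; split => //.
  rewrite /hA patchE mem_set/=; last by split => //=; rewrite in_itv/= t0s.
  by rewrite /h !ger0_norm ?enorm_ge0// addr0 addrA.
apply/cvgrPdist_lt => e e0.
(* The decaying term and the tail cost one [eta] each; the third leaves the strict inequality needed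
   for [d t < e]. *)
pose eta := m * e `^ p / 3.
have eta0 : 0 < eta by rewrite divr_gt0// mulr_gt0// powR_gt0.
have [s t0s tail] := integral_itv_tail t0 eta0 hA0 inthA.
near=> t.
have st : s <= t by near: t; apply: nbhs_pinfty_ge; exact: num_real.
have decay : w s * expR (- lam * (t - s)) <= eta by near: t; exact: expR_decay.
have t0t : t0 <= t by exact: le_trans st.
have [dt0 dwt] := dw t t0t.
have : ((w t)%:E <= (eta + eta)%:E)%E.
  apply: (le_trans (@gronwall_ge0 R s t lam 0 w hA st lam0 (lexx _) (w_ac s t t0s st)
    mhA hA0 _)).
    have ae_mu := ae_filter_ringOfSetsType (@lebesgue_measure R).
    by apply: filterS w'_hA => x + sx _; apply; exact: le_trans sx.
  rewrite mul0r addr0 EFinD; apply: leeD; first by rewrite lee_fin mulrC.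
  (* The exponential weight is at most 1, so the weighted integral is at most the tail. *)
  apply: le_trans (tail t st).
  apply: ge0_le_integral => //=.
  - by move=> x _; rewrite lee_fin mulr_ge0 ?expR_ge0.
  - apply/measurable_EFinP/measurable_funTS; apply: measurable_funM => //.
    apply: measurableT_comp => //.
    by apply: measurable_funM => //; exact: measurable_funB.
  - by apply/measurable_EFinP/measurable_funTS.
  - move=> x; rewrite in_itv/= => /andP[_ xt]; rewrite lee_fin.
    by rewrite ler_piMl// -expR0 ler_expR mulNr oppr_le0 mulr_ge0 ?subr_ge0// ltW.
rewrite lee_fin => wt; rewrite sub0r normrN ger0_norm// ltNge; apply/negP => ed.
have : m * e `^ p <= m * d t `^ p.
  by rewrite ler_pM2l//; apply: (ge0_ler_powR (ltW p0)); rewrite ?nnegrE// ltW.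
have : m * e `^ p = 3 * eta by rewrite /eta; field.
lra.
Unshelve. all: by end_near. Qed.

(** * Choice of the constants and derivation of the three claims *)

Theorem theorem4p12 (R : realType) (p m M c cu lambda : R)
    (p_ge1 : 1 <= p) (m_gt0 : 0 < m) (M_gt0 : 0 < M)
    (c_ge0 : 0 <= c) (cu_ge0 : 0 <= cu) (lambda_gt0 : 0 < lambda) :
  exists C C' : R, 0 < C /\ 0 < C' /\
  forall (n : nat) (t0 : R) (f : R -> 'rV[R]_n -> 'rV[R]_n) (vE : R -> R)
    (V1 V2 : R -> 'rV[R]_n -> R) (delta r : R)
    (u x : R -> 'rV[R]_n) (rho : R -> R),
  let mu := @lebesgue_measure R in
  let E := equilibria f in
  let W := fun t y => V1 t y + delta * V2 t y in
  let w := fun t => W t (x t) in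
  let d := fun t => dist (x t) (E t) in
  0 <= t0 ->
  (forall y i, lebesgue_measurable_fun `[t0, +oo[ (fun t => f t y ord0 i)) ->
  (\forall t \ae mu, t0 <= t -> locally_lipschitz (f t)) ->
  (forall t, t0 <= t -> E t !=set0 /\ closed (E t)) ->
  in_Lp_loc t0 1%E vE ->
  (\forall t \ae mu, t0 <= t -> 0 <= vE t) ->
  (forall radius s t : R, 0 < radius -> t0 <= s -> s <= t ->
    ((dAW radius (E t) (E s))%:E <= \int[mu]_(tau in `[s, t]) (vE tau)%:E)%E) ->
  0 < delta ->
  (forall (t : R) y, 0 <= t -> 0 <= V1 t y /\ 0 <= V2 t y) ->
  0 < r ->
  (forall t y, t0 <= t -> dist y (E t) <= r ->
    m * dist y (E t) `^ p <= W t y /\ W t y <= M * dist y (E t) `^ p) ->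
  in_vLp_loc t0 p%:E u ->
  is_solution t0 f u x ->
  (forall t, t0 <= t -> d t <= r) ->
  in_Lp_loc t0 p%:E rho ->
  (\forall t \ae mu, t0 <= t -> 0 <= rho t) ->
  loc_abs_cont t0 w ->
  (\forall t \ae mu, t0 <= t -> derivable w t 1 /\
    derive1 w t <= - lambda * w t + c * (vE t + rho t) `^ p
               + cu * enorm (u t) `^ p) ->
  (forall t, t0 <= t ->
    ((d t)%:E <=
       (C * expR (- lambda * (t - t0) / p) * d t0)%:E
       + C%:E * (\int[mu]_(s in `[t0, t])
           (expR (- lambda * (t - s)) * (vE s + rho s) `^ p)%:E) `^ p^-1
       + C%:E * vLp_norm `]t0, t[ +oo%E u)%E)
  /\
  (in_Lp `[t0, +oo[ +oo%E vE -> in_Lp `[t0, +oo[ +oo%E rho ->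
   in_vLp `[t0, +oo[ +oo%E u ->
    (limf_esup (fun t => (d t)%:E) (pinfty_nbhs R) <=
       C'%:E * (Lp_norm `[t0, +oo[ +oo%E vE + Lp_norm `[t0, +oo[ +oo%E rho
                + vLp_norm `[t0, +oo[ +oo%E u))%E)
  /\
  (in_Lp `[t0, +oo[ p%:E vE -> in_Lp `[t0, +oo[ p%:E rho ->
   in_vLp `[t0, +oo[ p%:E u ->
    d t @[t --> +oo] --> 0).
Proof.
have p_gt0 : 0 < p by exact: lt_le_trans p_ge1.
(* Each constant dominates the roots required by its estimate, and the 1 makes it positive. In [C']
   the quotient [c / lambda] comes from the constant forcing, and [M] is absent because the initial
   distance is forgotten in the limit. *)
pose C := 1 + (M / m) `^ p^-1 + (c / m) `^ p^-1 + (cu / lambda / m) `^ p^-1.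
pose C' := 1 + (c / lambda / m) `^ p^-1 + (cu / lambda / m) `^ p^-1.
have q1 := powR_ge0 (M / m) p^-1; have q2 := powR_ge0 (c / m) p^-1.
have q3 := powR_ge0 (cu / lambda / m) p^-1.
have q4 := powR_ge0 (c / lambda / m) p^-1.
have C_gt0 : 0 < C by rewrite /C; lra.
have MC : (M / m) `^ p^-1 <= C by rewrite /C; lra.
have cC : (c / m) `^ p^-1 <= C by rewrite /C; lra.
have cuC : (cu / lambda / m) `^ p^-1 <= C by rewrite /C; lra.
have C'_gt0 : 0 < C' by rewrite /C'; lra.
have cC' : (c / lambda / m) `^ p^-1 <= C' by rewrite /C'; lra.
have cuC' : (cu / lambda / m) `^ p^-1 <= C' by rewrite /C'; lra.
exists C, C'; split => //; split => //.
move=> n t0 f vE V1 V2 delta r u x rho mu E W w d t0_ge0 _ _ E_ne vE_loc vE_ge0 _ _ _ _.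
move=> W_bounds u_loc _ d_le_r rho_loc rho_ge0 w_ac w'_le.
have d_ge0 t : t0 <= t -> 0 <= d t by move=> /E_ne[+ _]; exact: dist_ge0.
have w_bounds t : t0 <= t -> m * d t `^ p <= w t /\ w t <= M * d t `^ p.
  by move=> t0t; apply: W_bounds => //; exact: d_le_r.
have u_ge0 s : 0 <= enorm (u s) by exact: enorm_ge0.
split; [|split].
- move=> t t0t; have [dw _] := w_bounds t t0t.
  have [_ wd] := w_bounds t0 (lexx _).
  have [mvE _] := vE_loc t t0t; have [mrho _] := rho_loc t t0t.
  exact: (pointwise_estimate p_ge1 m_gt0 (ltW M_gt0) c_ge0 cu_ge0 lambda_gt0 C_gt0
    MC cC cuC t0t (w_ac t t0t) mvE mrho u_ge0 (d_ge0 t0 (lexx _)) (d_ge0 t t0t)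
    dw wd w'_le).
- move=> [_ vEoo] [_ rhooo] [_ uoo].
  exact: (limsup_estimate p_ge1 m_gt0 (ltW M_gt0) c_ge0 cu_ge0 lambda_gt0 C'_gt0
    cC' cuC' w_ac vE_ge0 rho_ge0 u_ge0 d_ge0 w_bounds w'_le vEoo rhooo uoo).
- move=> vEp rhop up.
  apply: (@cvg0_estimate R n p m c cu lambda t0 vE rho w d u) => //.
  + move=> s t t0s st; apply: (abs_cont_subitv t0s); apply: w_ac.
    exact: le_trans t0s st.
  + by move=> t t0t; split; [exact: d_ge0|exact: (w_bounds t t0t).1].
Qed.
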